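(* Let $(\Omega,\mathcal{F})$ be a measurable space, let $\mathcal{P}=\{P_1,\dots,P_K\}$ be a finite set of probability measures on it, and let $X$ be a real random variable with $\max_{1\le i\le K}E_{P_i}[X^2]<\infty$. Then the upper variance of $X$ under $\mathcal{P}$ satisfies $$\overline{V}(X)=\max_{\boldsymbol{\lambda}\in\Delta^K}\left(\boldsymbol{\lambda}^T\boldsymbol{\kappa}-(\boldsymbol{\lambda}^T\boldsymbol{\mu})^2\right),$$ where $\boldsymbol{\kappa}=(E_{P_1}[X^2],\dots,E_{P_K}[X^2])^T$ and $\boldsymbol{\mu}=(E_{P_1}[X],\dots,E_{P_K}[X])^T$.
   Context: The upper variance of $X$ under $\mathcal{P}=\{P_1,\dots,P_K\}$ is $\overline{V}(X)=\min_{\mu\in M_X}\max_{1\le i\le K}E_{P_i}[(X-\mu)^2]$, where $M_X=[\min_{i}E_{P_i}[X],\ \max_{i}E_{P_i}[X]]$ (the minimum over $\mu\in\mathbb{R}$ gives the same value). $\Delta^K=\{\boldsymbol{\lambda}\in\mathbb{R}^K:\ \lambda_1+\cdots+\lambda_K=1,\ \lambda_i\ge 0,\ 1\le i\le K\}$ is the unit simplex. *)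

(* Defs.v *)
From HB Require Import structures.
From mathcomp Require Import all_boot all_order all_algebra.
From mathcomp Require Import all_classical all_reals all_analysis.

Set Implicit Arguments.
Unset Strict Implicit.
Unset Printing Implicit Defensive.

Import Order.TTheory GRing.Theory Num.Theory.

Local Open Scope classical_set_scope.
Local Open Scope ring_scope.
Local Open Scope ereal_scope.

Definition is_minimum {R : realType} (A : set (\bar R)) (v : \bar R) : Prop :=
  A v /\ lbound A v.

Definition is_maximum {R : realType} (A : set (\bar R)) (v : \bar R) : Prop :=
  A v /\ ubound A v.

(* For K > 0, the seeds -oo and +oo below never affect the value of a maximum
   or minimum over 'I_K. *)
Definition upper_second_moment {d : measure_display} {T : measurableType d}
    {R : realType} {K : nat} (P : 'I_K -> probability T R) (X : T -> R) :
    \bar R :=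
  \big[maxe/-oo]_(i < K) 'E_(P i)[fun w => (X w ^+ 2)%R].

Definition mean_interval {d : measure_display} {T : measurableType d}
    {R : realType} {K : nat} (P : 'I_K -> probability T R) (X : T -> R) :
    set R :=
  [set m : R | \big[mine/+oo]_(i < K) 'E_(P i)[X] <= m%:E
               /\ m%:E <= \big[maxe/-oo]_(i < K) 'E_(P i)[X]].

Definition max_sq_deviation {d : measure_display} {T : measurableType d}
    {R : realType} {K : nat} (P : 'I_K -> probability T R) (X : T -> R)
    (m : R) : \bar R :=
  \big[maxe/-oo]_(i < K) 'E_(P i)[fun w => ((X w - m) ^+ 2)%R].

(* An infimum, so that it is a total function; that it is attained, i.e. is the
   minimum, has to be stated separately with is_minimum. *)
Definition upper_variance {d : measure_display} {T : measurableType d}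
    {R : realType} {K : nat} (P : 'I_K -> probability T R) (X : T -> R) :
    \bar R :=
  ereal_inf [set max_sq_deviation P X m | m in mean_interval P X].

Definition unit_simplex {R : realType} {K : nat} : set 'cV[R]_K :=
  [set lam : 'cV[R]_K | (\sum_(i < K) lam i 0 = 1)%R
                        /\ forall i : 'I_K, (0 <= lam i 0)%R].

(* The expectations are extended reals; fine loses nothing when E[X^2] < +oo. *)
Definition second_moment_vec {d : measure_display} {T : measurableType d}
    {R : realType} {K : nat} (P : 'I_K -> probability T R) (X : T -> R) :
    'cV[R]_K :=
  (\col_(i < K) fine 'E_(P i)[fun w => (X w ^+ 2)%R])%R.

Definition mean_vec {d : measure_display} {T : measurableType d}
    {R : realType} {K : nat} (P : 'I_K -> probability T R) (X : T -> R) :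
    'cV[R]_K :=
  (\col_(i < K) fine 'E_(P i)[X])%R.

Definition mixture_variance {R : realType} {K : nat}
    (kappa mu lam : 'cV[R]_K) : R :=
  ((lam^T *m kappa) 0 0 - ((lam^T *m mu) 0 0) ^+ 2)%R.

(* Main.v *)
Require Import Defs.
From HB Require Import structures.
From mathcomp Require Import all_boot all_order all_algebra.
From mathcomp Require Import all_classical all_reals all_analysis.
From mathcomp Require Import measurable_realfun.
From mathcomp Require Import ring lra.

(** The identity is a minimax theorem for the payoff
      g(m, lam) = sum_i lam_i E_i[(X - m)^2] = sum_i lam_i (kappa_i - 2 m mu_i + m^2).
    Maximising g over the simplex for fixed m gives max_i E_i[(X - m)^2], since a
    linear function is largest at a vertex. Minimising over m for fixed lam gives
    the mixture variance lam.kappa - (lam.mu)^2, attained at m = lam.mu, since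
      g(m, lam) = lam.kappa - (lam.mu)^2 + (m - lam.mu)^2.
    Hence every mixture variance is below every worst-case squared deviation
    ([mixture_variance_le]), and it remains to exhibit a saddle point.

    The mixture variance is continuous on a compact simplex, so it has a
    maximiser lam ([mixture_variance_argmax]). Moving from lam towards the vertex
    e_i cannot increase it; the derivative of the mixture variance at lam in that
    direction is
      kappa_i - lam.kappa - 2 (lam.mu) (mu_i - lam.mu),
    and its being nonpositive says exactly that E_i[(X - m)^2] is at most the
    mixture variance of lam, for m = lam.mu ([mixture_variance_first_order]). So
    the worst-case deviation at this m meets its lower bound. This m is a convex
    combination of the means, so it lies in the interval over which the upper
    variance is taken, and no minimiser has to be sought separately.

    The probabilistic content is the expansion of E[(X - m)^2] in terms of the
    first two moments, which are finite because E[X^2] is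
    ([expectation_sqr_dev]). *)

Set Implicit Arguments.
Unset Strict Implicit.
Unset Printing Implicit Defensive.

Import Order.TTheory GRing.Theory Num.Theory.
Import numFieldNormedType.Exports.

Local Open Scope classical_set_scope.
Local Open Scope ring_scope.

(** * Averages over the simplex and weak duality *)

Lemma mixture_varianceE (R : realType) (K : nat) (kappa mu lam : 'cV[R]_K) :
  mixture_variance kappa mu lam =
  (\sum_i lam i 0 * kappa i 0 - (\sum_i lam i 0 * mu i 0) ^+ 2).
Proof.
by rewrite /mixture_variance !mxE; congr (_ - _ ^+ 2);
  apply: eq_bigr => i _; rewrite mxE.
Qed.

Lemma simplex_mean_le (R : realType) (K : nat) (lam : 'cV[R]_K)
    (c : 'I_K -> R) (C : R) :
  unit_simplex lam -> (forall i, c i <= C) -> \sum_i lam i 0 * c i <= C.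
Proof.
move=> [lam1 lam0] cC; rewrite -[leRHS]mul1r -lam1 mulr_suml.
by apply: ler_sum => i _; apply: ler_wpM2l.
Qed.

Lemma simplex_mean_ge (R : realType) (K : nat) (lam : 'cV[R]_K)
    (c : 'I_K -> R) (C : R) :
  unit_simplex lam -> (forall i, C <= c i) -> C <= \sum_i lam i 0 * c i.
Proof.
move=> [lam1 lam0] cC; rewrite -[leLHS]mul1r -lam1 mulr_suml.
by apply: ler_sum => i _; apply: ler_wpM2l.
Qed.

(** Weak duality. The average of kappa_i - 2 m mu_i + m^2 under lam exceeds the
    mixture variance by the square (m - lam.mu)^2. *)
Lemma mixture_variance_le (R : realType) (K : nat) (kappa mu lam : 'cV[R]_K)
    (m C : R) :
  unit_simplex lam ->
  (forall i, kappa i 0 - 2 * m * mu i 0 + m ^+ 2 <= C) ->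
  mixture_variance kappa mu lam <= C.
Proof.
move=> slam /(simplex_mean_le slam); rewrite mixture_varianceE.
set a := \sum_i lam i 0 * kappa i 0; set b := \sum_i lam i 0 * mu i 0.
have -> : \sum_i lam i 0 * (kappa i 0 - 2 * m * mu i 0 + m ^+ 2) =
    a - 2 * m * b + m ^+ 2.
  case: slam => lam1 _.
  rewrite /a /b mulr_sumr -sumrB -[in RHS](mul1r (m ^+ 2)) -lam1 mulr_suml.
  by rewrite -big_split; apply: eq_bigr => i _ /=; ring.
by have := sqr_ge0 (b - m); lra.
Qed.

(** * A maximiser of the mixture variance and its optimality condition *)

Lemma continuous_coord_sum (R : realType) (K : nat) (c : 'I_K -> R) :
  continuous (fun v : 'rV[R]_K => \sum_i v 0 i * c i).
Proof.
apply: continuous_big => [|i _ v]; first exact: add_continuous.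
apply: (@continuousM _ _ (fun x : 'rV[R]_K => x 0 i) (fun=> c i)).
  exact: coord_continuous.
exact: cst_continuous.
Qed.

(** The simplex is the intersection of the cube [0, 1]^K, compact by Tychonoff's
    theorem, with a closed hyperplane. *)
Lemma compact_unit_simplex (R : realType) (K : nat) :
  compact [set v : 'rV[R]_K | unit_simplex v^T].
Proof.
have -> : [set v : 'rV[R]_K | unit_simplex v^T] =
    [set v : 'rV[R]_K | forall i, `[0, 1]%classic (v 0 i)] `&`
    (fun v : 'rV[R]_K => \sum_i v 0 i * 1) @^-1` [set 1].
  apply/seteqP; split=> v /=.
    move=> [v1 v0].
    have {}v1 : (\sum_i v 0 i = 1).
      by rewrite -v1; apply: eq_bigr => i _; rewrite mxE.
    have {}v0 i : (0 <= v 0 i) by have := v0 i; rewrite mxE.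
    split; last by apply: etrans v1; apply: eq_bigr => i _; rewrite mulr1.
    move=> i; rewrite in_itv /= v0 /= -[leRHS]v1 (bigD1 i) //= lerDl.
    by apply: sumr_ge0 => j _.
  move=> [v01 v1]; split.
    by apply: etrans v1; apply: eq_bigr => i _; rewrite mxE mulr1.
  by move=> i; rewrite mxE; have := v01 i; rewrite in_itv /= => /andP[].
apply: compact_closedI.
  refine (@rV_compact R K (fun=> `[0, 1]%classic) _) => i.
  exact: segment_compact.
apply: preimage_closed; last exact: closed_eq.
by move=> v _; exact: continuous_coord_sum.
Qed.

Lemma mixture_variance_argmax (R : realType) (K : nat) (kappa mu : 'cV[R]_K) :
  (0 < K)%N ->
  exists2 lam, unit_simplex lam & forall lam', unit_simplex lam' ->
    (mixture_variance kappa mu lam' <= mixture_variance kappa mu lam).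
Proof.
move=> K0; pose f (v : 'rV[R]_K) := mixture_variance kappa mu v^T.
have cf : continuous f.
  have -> : f = (fun v => \sum_i v 0 i * kappa i 0 -
                          (\sum_i v 0 i * mu i 0) * (\sum_i v 0 i * mu i 0)).
    apply/funext => v; rewrite /f mixture_varianceE expr2.
    by congr (_ - _ * _); apply: eq_bigr => i _; rewrite mxE.
  have ck := @continuous_coord_sum R K (kappa ^~ 0).
  have cm := @continuous_coord_sum R K (mu ^~ 0).
  move=> v; apply: (continuousB (ck v)).
  exact: (continuousM (cm v) (cm v)).
have [] := @EVT_max_rV R K f [set v | unit_simplex v^T].
- exists (\row_i (i == Ordinal K0)%:R); split.
    rewrite (bigD1 (Ordinal K0)) //= big1 ?mxE ?eqxx ?addr0 // => i /negPf i0.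
    by rewrite !mxE i0.
  by move=> i; rewrite !mxE ler0n.
- exact: compact_unit_simplex.
- exact: continuous_subspaceT.
- move=> v; rewrite inE => sv vmax; exists v^T => // lam slam.
  by have := vmax lam^T; rewrite /f trmxK; apply; rewrite inE /= trmxK.
Qed.

(** The optimality condition at a maximiser, in the direction of the vertex e_i:
    the inequality is a rearrangement of the nonpositivity of the directional
    derivative [D] below. *)
Lemma mixture_variance_first_order (R : realType) (K : nat)
    (kappa mu lam : 'cV[R]_K) :
  unit_simplex lam ->
  (forall lam', unit_simplex lam' ->
    mixture_variance kappa mu lam' <= mixture_variance kappa mu lam) ->
  forall i, (kappa i 0 - 2 * (\sum_j lam j 0 * mu j 0) * mu i 0
             + (\sum_j lam j 0 * mu j 0) ^+ 2 <= mixture_variance kappa mu lam).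
Proof.
move=> [lam1 lam0] lammax i; rewrite mixture_varianceE.
set a := (\sum_j lam j 0 * kappa j 0); set b := (\sum_j lam j 0 * mu j 0).
have segE (c : 'cV[R]_K) t :
    (\sum_j ((1 - t) *: lam + t *: delta_mx i 0) j 0 * c j 0 =
     (1 - t) * (\sum_j lam j 0 * c j 0) + t * c i 0).
  have -> : (c i 0 = \sum_j (j == i)%:R * c j 0).
    rewrite (bigD1 i) //= eqxx mul1r big1 ?addr0 // => j /negPf ->.
    by rewrite mul0r.
  rewrite !mulr_sumr -big_split; apply: eq_bigr => j _ /=.
  by rewrite !mxE eqxx andbT; ring.
pose D := (kappa i 0 - a - 2 * b * (mu i 0 - b)).
(* Along the segment the mixture variance is t * D - t^2 (mu_i - b)^2 above its
   value at lam, so maximality bounds D by a quantity that vanishes with t. *)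
have Dle t : (0 < t <= 1) -> (D <= t * (mu i 0 - b) ^+ 2).
  move=> /andP[t0 t1].
  have st : unit_simplex ((1 - t) *: lam + t *: delta_mx i 0).
    split=> [|j].
      have := segE (const_mx 1) t.
      under eq_bigr do rewrite [const_mx _ _ _]mxE mulr1.
      under [in RHS]eq_bigr do rewrite [const_mx _ _ _]mxE mulr1.
      by rewrite lam1 mxE => ->; ring.
    by rewrite !mxE addr_ge0 ?mulr_ge0 ?ler0n ?subr_ge0 // ltW.
  have := lammax _ st; rewrite !mixture_varianceE !segE -/a -/b.
  by move=> le_st; rewrite -(ler_pM2l t0) /D; lra.
(* If D were positive, t = D / (2 (mu_i - b)^2) would give D <= D / 2; when this
   t exceeds 1, t = 1 gives a contradiction instead. *)
have D0 : (D <= 0).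
  rewrite leNgt; apply/negP => D0.
  have [s0|s0] := leP (D / 2) ((mu i 0 - b) ^+ 2); last first.
    by have := Dle 1; rewrite ltr01 lexx mul1r => /(_ isT); lra.
  have S0 : (0 < (mu i 0 - b) ^+ 2) by lra.
  have := Dle (D / 2 / (mu i 0 - b) ^+ 2).
  rewrite divfK ?gt_eqF // ler_pdivrMr // mul1r s0 !divr_gt0 //=.
  by move=> /(_ isT); lra.
by move: D0; rewrite /D; lra.
Qed.

(** * Moments under a single probability *)

Local Open Scope ereal_scope.

Lemma sqr_Lfun1 (R : realType) (d : measure_display) (T : measurableType d)
    (P : probability T R) (X : {mfun T >-> R}) :
  'E_P[fun w => (X w ^+ 2)%R] < +oo ->
  (fun w => X w ^+ 2)%R \in Lfun P 1.
Proof.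
move=> X2; apply/Lfun1_integrable/integrableP; split.
  by apply/measurable_EFinP; exact: measurable_funX.
move: X2; rewrite unlock; apply: le_lt_trans.
by under eq_integral => w _ do rewrite /= ger0_norm ?sqr_ge0 //.
Qed.

(** X is dominated by 1 + X^2, which is integrable because P is finite. *)
Lemma Lfun1_of_sqr (R : realType) (d : measure_display) (T : measurableType d)
    (P : probability T R) (X : {mfun T >-> R}) :
  'E_P[fun w => (X w ^+ 2)%R] < +oo ->
  (X : T -> R) \in Lfun P 1.
Proof.
move=> X2; apply/Lfun1_integrable.
apply: (@le_integrable _ _ _ P setT _ _ (EFin \o (fun w => 1 + X w ^+ 2)%R)) => //.
- exact/measurable_EFinP.
- move=> w _ /=; rewrite lee_fin [leRHS]ger0_norm ?addr_ge0 ?sqr_ge0 //.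
  by rewrite ler_norml; apply/andP; split; nra.
- apply/Lfun1_integrable.
  by apply: (@rpredD _ (Lfun P 1) (cst 1%R)); [exact: Lfun_cst|exact: sqr_Lfun1].
Qed.

Lemma expectation_sqr_dev (R : realType) (d : measure_display) (T : measurableType d)
    (P : probability T R) (X : {mfun T >-> R}) (m : R) :
  'E_P[fun w => (X w ^+ 2)%R] < +oo ->
  'E_P[fun w => ((X w - m) ^+ 2)%R] =
  (fine 'E_P[fun w => (X w ^+ 2)%R] - 2 * m * fine 'E_P[X] + m ^+ 2)%:E.
Proof.
move=> X2; have L2 := sqr_Lfun1 X2; have L1 := Lfun1_of_sqr X2.
have Lc : cst (m ^+ 2)%R \in Lfun P 1 by exact: Lfun_cst.
have LZ : ((2 * m)%R \o* X) \in Lfun P 1 by apply: Lfun_scale.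
have -> : (fun w => ((X w - m) ^+ 2)%R) =
    ((fun w => X w ^+ 2) \- ((2 * m) \o* X) \+ cst (m ^+ 2))%R.
  by apply/funext => w /=; ring.
have LB : ((fun w => X w ^+ 2) \- ((2 * m) \o* X))%R \in Lfun P 1.
  exact: (@rpredB _ (Lfun P 1)).
rewrite (expectationD LB Lc) (expectationB L2 LZ) (expectationZl _ L1).
by rewrite expectation_cst EFinD EFinB (EFinM _ (fine _)) !fineK
  ?expectation_fin_num.
Qed.

(** * The minimax identity *)

Theorem proposition4p1 (R : realType) (d : measure_display)
    (T : measurableType d) (K : nat) (hK : (0 < K)%N)
    (P : 'I_K -> probability T R) (X : {mfun T >-> R})
    (hX : upper_second_moment P X < +oo) :
  is_minimum [set max_sq_deviation P X m | m in mean_interval P X]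
             (upper_variance P X)
  /\
  is_maximum [set (mixture_variance (second_moment_vec P X) (mean_vec P X)
                                    lam)%:E | lam in @unit_simplex R K]
             (upper_variance P X).
Proof.
set kappa := second_moment_vec P X; set mu := mean_vec P X.
have X2 i : 'E_(P i)[fun w => (X w ^+ 2)%R] < +oo.
  by apply: le_lt_trans hX; exact: (le_bigmax _ (fun i => 'E_(P i)[_])).
have meanE i : 'E_(P i)[X] = (mu i 0)%:E.
  by rewrite mxE fineK ?expectation_fin_num ?Lfun1_of_sqr.
have devE m i : 'E_(P i)[fun w => ((X w - m) ^+ 2)%R] =
    (kappa i 0 - 2 * m * mu i 0 + m ^+ 2)%:E.
  by rewrite expectation_sqr_dev // !mxE.
have weak m lam : unit_simplex lam ->
    (mixture_variance kappa mu lam)%:E <= max_sq_deviation P X m.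
  move=> slam; rewrite /max_sq_deviation.
  (* K > 0 makes the maximum the deviation of some index, hence a real number. *)
  have [i _ maxE] := @eq_bigmax _ _ _ -oo (Ordinal hK) xpredT
    (fun i => 'E_(P i)[fun w => ((X w - m) ^+ 2)%R]) isT (fun i _ => leNye _).
  rewrite maxE devE lee_fin; apply: (mixture_variance_le slam) => j.
  by rewrite -lee_fin -!devE -maxE; exact: le_bigmax.
have [lam slam lammax] := @mixture_variance_argmax _ _ kappa mu hK.
pose m := (\sum_j lam j 0 * mu j 0)%R.
have m_in : mean_interval P X m.
  split.
    have [i _ minE] := @eq_bigmin _ _ _ +oo (Ordinal hK) xpredT
      (fun i => 'E_(P i)[X]) isT (fun i _ => leey _).
    rewrite minE meanE lee_fin; apply: (simplex_mean_ge slam) => j.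
    by rewrite -lee_fin -!meanE -minE; exact: bigmin_le.
  have [i _ maxE] := @eq_bigmax _ _ _ -oo (Ordinal hK) xpredT
    (fun i => 'E_(P i)[X]) isT (fun i _ => leNye _).
  rewrite maxE meanE lee_fin; apply: (simplex_mean_le slam) => j.
  by rewrite -lee_fin -!meanE -maxE; exact: le_bigmax.
have dev_m : max_sq_deviation P X m <= (mixture_variance kappa mu lam)%:E.
  apply/bigmax_leP; split=> [|i _]; first exact: leNye.
  by rewrite devE lee_fin; exact: mixture_variance_first_order.
have dev_mE : max_sq_deviation P X m = (mixture_variance kappa mu lam)%:E.
  by apply/eqP; rewrite eq_le dev_m weak.
have uvE : upper_variance P X = (mixture_variance kappa mu lam)%:E.
  apply/eqP; rewrite eq_le; apply/andP; split.
    by rewrite -dev_mE; apply: ereal_inf_lbound; exists m.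
  by apply: le_ereal_inf_tmp => _ [m' _ <-]; exact: weak.
rewrite uvE; split; split.
- by exists m.
- by move=> _ [m' _ <-]; exact: weak.
- by exists lam.
- by move=> _ [lam' slam' <-]; rewrite lee_fin; exact: lammax.
Qed.
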